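(* Let $\mathcal{G}=(V,E)$ be a connected simple graph. Let $\mathcal{F}_3$ be the set of policies (routes) obtained from the CPP (Chinese Postman Problem) approximation scheme, i.e. the routes in $\mathcal{G}$ that follow an Eulerian cycle of an Eulerian multigraph $\mathcal{G}''\supseteq\mathcal{G}$ obtained by duplicating edges of $\mathcal{G}$ with the shortest total length. Let $R_1^*$ and $R^*$ denote the optimal policies (those minimizing the time-average AoI) within the policy sets $\mathcal{F}_1$ and $\mathcal{F}$, respectively, and let $E_1^*\subseteq E$ be the set of edges that are traversed once under $R_1^*$. Then for all routes $R_3\in\mathcal{F}_3$, with $E_1\subseteq E$ the set of edges that are traversed once under $R_3$, $$\frac{\overline{\Delta}(\mathcal{G};R_3)}{\overline{\Delta}(\mathcal{G};R_1^* )}\le \frac{l(E)^2-\frac12 l(E)\,l(E_1)}{\frac12 l(E)^2+\frac14 l(E_1^* )\,\bigl(l(E)-l(E_1^* )\bigr)}\le 2$$ and $$\frac{\overline{\Delta}(\mathcal{G};R_3)}{\overline{\Delta}(\mathcal{G};R^* )}\le \frac{l(E)^2-\frac12 l(E)\,l(E_1)}{\frac12 l(E)^2}\le 2 .$$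
   Context: $\mathcal{G}=(V,E)$ is a connected simple graph with finitely many nodes; each edge $e$ is regarded as a segment of positive length $l(e)$, and $l(F)=\sum_{e\in F}l(e)$ for $F\subseteq E$. Policies: a single UAV moves along the edges at unit speed and must patrol all the edges. $\mathcal{F}$ is the set of patrol policies under which all edges are traversed by the UAV without changing direction halfway along an edge and the UAV never halts while traversing; policies in $\mathcal{F}$ may be non-periodic. Age: for a point $x$ on an edge, the temporary age at time $t$ is $\Delta(x,t)=t-U(x,t)$, where $U(x,t)$ is the most recent time that $x$ was visited. It is assumed throughout that the temporary age at time $t$ is finite almost everywhere, i.e. the set of points of infinite age has length $0$. The time-average Age of Information (AoI) under policy $\psi$ is $$\overline{\Delta}(\mathcal{G};\psi)=\lim_{T\to\infty}\frac1T\int_0^T\int_{x\in\bigcup_{e\in E} e}\Delta(x,t)\,dx\,dt .$$ Routes: a route is a closed walk $R=(R[0],\dots,R[M])$ in $\mathcal{G}$, $R[0]=R[M]$, traversing every edge at least once and at most twice (in any directions) before returning to the starting node. $\mathcal{F}_1\subset\mathcal{F}$ is the set of periodic policies that repeat a route forever; a route is identified with this policy, and $\overline\Delta(\mathcal{G};R)$ is its AoI. The multigraph $\mathcal{G}''$: edges of $\mathcal{G}$ of minimum total length are duplicated so that all node degrees become even (the solution of the Chinese Postman Problem, i.e. of finding a closed walk of minimum length traversing all edges). An Eulerian cycle of a multigraph is a closed walk using each edge (counted with multiplicity) exactly once; an Eulerian cycle of $\mathcal{G}''$ is viewed as a route in $\mathcal{G}$. *)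

(* Defs.v *)
From HB Require Import structures.
From mathcomp Require Import all_boot all_order all_algebra.
From mathcomp Require Import all_classical all_reals all_analysis.

Set Implicit Arguments.
Unset Strict Implicit.
Unset Printing Implicit Defensive.

Import Order.TTheory GRing.Theory Num.Theory.
Import numFieldNormedType.Exports.

Local Open Scope classical_set_scope.
Local Open Scope ring_scope.

(* A simple graph is a symmetric irreflexive [adj] on a
   finType; its edges are unordered pairs, and [len e] is the length of [e]. *)

Definition edge (V : finType) (u v : V) : {set V} := [set u; v]%SET.

Definition edges (V : finType) (adj : rel V) : {set {set V}} :=
  [set edge d.1 d.2 | d : V * V & adj d.1 d.2]%SET.

Definition total_length (R : realType) (V : finType) (len : {set V} -> R)
    (F : {set {set V}}) : R :=
  \sum_(e in F) len e.

(* A policy is given by the two-sided sequence [w] of the nodes met by the UAV: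
   it runs along the edge from [w n] to [w (n + 1)] at unit speed, without
   halting or turning back inside the edge, then leaves for [w (n + 2)].  The
   averaging clock starts at time 0, when the UAV is at [w 0].  The sequence
   extends to the past because an age at time 0 that is finite almost everywhere
   requires visits before time 0. *)

Definition arrival (R : realType) (V : finType) (len : {set V} -> R)
    (w : int -> V) (n : int) : R :=
  match n with
  | Posz k => \sum_(i < k) len (edge (w (Posz i)) (w (Posz i + 1)))
  | Negz k => - \sum_(i < k.+1) len (edge (w (Negz i)) (w (Negz i + 1)))
  end.

(* For adjacent [u], [v] and 0 < x < len (edge u v), the triple (u, v, x) is the
   point of the edge {u, v} at distance x from u; it is also the triple
   (v, u, len (edge u v) - x).  Nodes are not represented: they form a set of
   length 0. *)
Definition visits (R : realType) (V : finType) (len : {set V} -> R)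
    (w : int -> V) (u v : V) (x : R) : set R :=
  [set s | exists n : int,
     [/\ w n = u, w (n + 1) = v & s = arrival len w n + x] \/
     [/\ w n = v, w (n + 1) = u
       & s = arrival len w n + (len (edge u v) - x)]].

(* -oo for a point that was never visited, whose age is therefore +oo.  The
   visits to a point are discrete, so this supremum is otherwise attained. *)
Definition last_visit (R : realType) (V : finType) (len : {set V} -> R)
    (w : int -> V) (u v : V) (x t : R) : \bar R :=
  ereal_sup (EFin @` (visits len w u v x `&` [set s | s <= t])).

Definition age (R : realType) (V : finType) (len : {set V} -> R)
    (w : int -> V) (u v : V) (x t : R) : \bar R :=
  (t%:E - last_visit len w u v x t)%E.

(* Each edge is integrated over once, through the orientation in which the
   endpoint of smaller rank comes first. *)
Definition total_age (R : realType) (V : finType) (adj : rel V)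
    (len : {set V} -> R) (w : int -> V) (t : R) : \bar R :=
  (\sum_(d : V * V | adj d.1 d.2 && (enum_rank d.1 < enum_rank d.2)%N)
     \int[lebesgue_measure]_(x in `]0%R, len (edge d.1 d.2)[)
        age len w d.1 d.2 x t)%E.

Definition mean_age (R : realType) (V : finType) (adj : rel V)
    (len : {set V} -> R) (w : int -> V) (T : R) : \bar R :=
  ((T^-1)%:E * \int[lebesgue_measure]_(t in `[0%R, T]) total_age adj len w t)%E.

Definition AoI (R : realType) (V : finType) (adj : rel V)
    (len : {set V} -> R) (w : int -> V) : \bar R :=
  lim (mean_age adj len w T @[T --> +oo]).

Definition patrol_policies (R : realType) (V : finType) (adj : rel V)
    (len : {set V} -> R) : set (int -> V) :=
  [set w | [/\ forall n, adj (w n) (w (n + 1)),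
               forall e, e \in edges adj ->
                 exists n, e = edge (w n) (w (n + 1))
             & forall (t : R) (u v : V), 0 <= t -> adj u v ->
                 lebesgue_measure [set x : R | 0 < x < len (edge u v) /\
                                      age len w u v x t = +oo%E] = 0%E]].

(* The policies competing for optimality are those with a time-average AoI, i.e.
   for which the defining limit exists, possibly as +oo. *)
Definition optimal (R : realType) (V : finType) (adj : rel V)
    (len : {set V} -> R) (P : set (int -> V)) (w : int -> V) : Prop :=
  [/\ P w, cvg (mean_age adj len w T @[T --> +oo])
    & forall w', P w' -> cvg (mean_age adj len w' T @[T --> +oo]) ->
        (AoI adj len w <= AoI adj len w')%E].

(* The sequence x :: p is the closed walk (R[0], ..., R[M]), with M = size p. *)
Definition closed_walk (V : finType) (adj : rel V) (x : V) (p : seq V) : Prop :=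
  [/\ p != [::], path adj x p & last x p = x].

Definition traversals (V : finType) (x : V) (p : seq V) (e : {set V}) : nat :=
  count (fun d : V * V => edge d.1 d.2 == e) (zip (x :: p) p).

Definition route (V : finType) (adj : rel V) (x : V) (p : seq V) : Prop :=
  closed_walk adj x p /\
  forall e, e \in edges adj -> (1 <= traversals x p e <= 2)%N.

Definition forever (V : finType) (x : V) (p : seq V) : int -> V :=
  fun n => nth x (x :: p) `|(n %% Posz (size p))%Z|%N.

Definition route_policies (V : finType) (adj : rel V) : set (int -> V) :=
  [set w | exists x p, route adj x p /\ w = forever x p].

Definition traversed_once (V : finType) (adj : rel V) (x : V) (p : seq V) :
    {set {set V}} :=
  [set e in edges adj | traversals x p e == 1%N]%SET.

Definition eulerian_duplication (V : finType) (adj : rel V)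
    (D : {set {set V}}) : Prop :=
  D \subset edges adj /\
  forall v : V, ~~ odd (\sum_(e in edges adj | v \in e) (1 + (e \in D)))%N.

Definition postman_duplication (R : realType) (V : finType) (adj : rel V)
    (len : {set V} -> R) (D : {set {set V}}) : Prop :=
  eulerian_duplication adj D /\
  forall D', eulerian_duplication adj D' ->
    total_length len D <= total_length len D'.

(* An Eulerian cycle of the multigraph in which the edges of [D] are doubled. *)
Definition postman_route (R : realType) (V : finType) (adj : rel V)
    (len : {set V} -> R) (x : V) (p : seq V) : Prop :=
  exists D, [/\ postman_duplication adj len D, closed_walk adj x p
    & forall e, e \in edges adj -> traversals x p e = (1 + (e \in D))%N].

(* Main.v *)
Require Import Defs.
From HB Require Import structures.
From mathcomp Require Import all_boot all_order all_algebra.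
From mathcomp Require Import all_classical all_reals all_analysis.
From mathcomp Require Import measurable_realfun.
From mathcomp Require Import ring lra zify.

Set Implicit Arguments.
Unset Strict Implicit.
Unset Printing Implicit Defensive.

Import Order.TTheory GRing.Theory Num.Theory.
Import numFieldNormedType.Exports.

Local Open Scope classical_set_scope.
Local Open Scope ring_scope.

(* At unit speed, the points visited during a time window of length [a] have
   total length at most [a]; hence so do the points of age less than [a] at a
   given time, and by the layer-cake formula the total age is at every time at
   least the integral of [l(E) - a] over [0, l(E)], that is, [l(E)^2 / 2].

   Dually, fix a point visited [m] times per period [L] by a route: the times at
   which its age is less than [a] have density at most [m a / L], so its mean
   age is at least [L / (2 m)].  It is at most [L / 2], because the age is at
   most the time elapsed since the last visit of any given class modulo [L].
   Fubini exchanges the averages over time and space, and [L = 2 l(E) - l(E_1)]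
   turns the sums over the edges into the numerator and the denominators. *)

(** * Layer-cake lower bound *)

(** For [h > 0] the sum is [min(x, n h)] rounded down to a multiple of [h]. The induction carries
    the second bound [n h] along: if the last term is present, then [(n + 1) h <= x] and this bound
    suffices; otherwise nothing is added. *)
Lemma sum_steps_le (R : realType) (h : R) (x : \bar R) (n : nat) : 0 <= h ->
  (0 <= x)%E ->
  (\sum_(k < n) (h * (((k.+1%:R * h)%:E <= x)%E : bool)%:R)%:E <= x)%E.
Proof.
move=> h0 x0.
suff [] : (\sum_(k < n) (h * (((k.+1%:R * h)%:E <= x)%E : bool)%:R)%:E <= x)%E
  /\ (\sum_(k < n) (h * (((k.+1%:R * h)%:E <= x)%E : bool)%:R)%:E
      <= (n%:R * h)%:E)%E by [].
elim: n => [|n [IHx IHn]]; first by rewrite big_ord0 mul0r.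
rewrite big_ord_recr /=; have [nx|_] := leP ((n.+1%:R * h)%:E) x; last first.
  rewrite mulr0n mulr0 adde0; split=> //; rewrite (le_trans IHn)// lee_fin.
  by rewrite ler_wpM2r// ler_nat.
have le_n : (\sum_(k < n) (h * (((k.+1%:R * h)%:E <= x)%E : bool)%:R)%:E
    + (h * true%:R)%:E <= (n.+1%:R * h)%:E)%E.
  by rewrite mulr1n mulr1 -natr1 mulrDl mul1r EFinD leeD2r.
by split=> //; rewrite (le_trans le_n).
Qed.

(* A layer-cake estimate: [\sum_i \int f_i] is at least the integral over
   [0, M / c] of [M - c * a], the least measure left for the superlevel sets. *)
Lemma sum_integral_ge (d : measure_display) (T : measurableType d)
    (R : realType) (mu : {measure set T -> \bar R}) (I : finType) (P : pred I)
    (D : I -> set T) (f : I -> T -> \bar R) (M c : R) :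
  (forall i, P i -> measurable (D i)) ->
  (forall i, P i -> measurable_fun (D i) (f i)) ->
  (forall i x, P i -> D i x -> (0 <= f i x)%E) ->
  0 <= M -> 0 < c ->
  (\sum_(i | P i) mu (D i) = M%:E)%E ->
  (forall a, 0 < a -> a <= M / c ->
    (\sum_(i | P i) mu (D i `&` [set x | f i x < a%:E]) <= (c * a)%:E)%E) ->
  ((M ^+ 2 / (2 * c))%:E <= \sum_(i | P i) \int[mu]_(x in D i) f i x)%E.
Proof.
move=> mD mf f0 M0 c0 muD muf.
have finD i : P i -> mu (D i) \is a fin_num.
  move=> Pi; rewrite ge0_fin_numE// (le_lt_trans _ (ltry M))// -muD.
  by rewrite (bigD1 i)//= leeDl// sume_ge0.
have mlt i a : P i -> measurable (D i `&` [set x | (f i x < a%:E)%E]).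
  by move=> Pi; apply: emeasurable_fun_infty_o => //; [exact: mD|exact: mf].
have mge i a : P i -> measurable (D i `&` [set x | (a%:E <= f i x)%E]).
  by move=> Pi; apply: emeasurable_fun_c_infty => //; [exact: mD|exact: mf].
(* Superlevel and sublevel sets partition each [D i], so the upper bound on sublevels becomes a
   lower bound on superlevels. *)
have superlevel a : 0 < a -> a <= M / c ->
    ((M - c * a)%:E <= \sum_(i | P i) mu (D i `&` [set x | a%:E <= f i x]))%E.
  move=> a0 aM; rewrite EFinB leeBlDr//.
  rewrite (le_trans _ (leeD2l _ (muf a a0 aM)))// -muD -big_split/=.
  apply: lee_sum => i Pi; rewrite -measureU; [|exact: mge|exact: mlt|]; last first.
    by apply/seteqP; split=> // x [[_ /= ?] [_ /=]]; rewrite ltNge => /negP.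
  rewrite -setIUr; rewrite le_eqVlt; apply/orP; left; apply/eqP.
  congr (mu _); apply/seteqP.
  by split=> x => [Dx|[]//]; split=> //=; case: (leP (a%:E) (f i x)); [left|right].
have steps n : (0 < n)%N ->
    ((M ^+ 2 / (2 * c) * (1 - n%:R^-1))%:E
      <= \sum_(i | P i) \int[mu]_(x in D i) f i x)%E.
  (* Cut [[0, M / c]] into [n] pieces: the right-endpoint Riemann sum of [M - c a] with mesh [h]
     equals [M^2 / (2 c) (1 - 1 / n)]. *)
  move=> n0; pose h := M / c / n%:R.
  have h0 : 0 <= h by rewrite /h divr_ge0// divr_ge0// ltW.
  have n0' : n%:R != 0 :> R by rewrite pnatr_eq0 -lt0n.
  have c0' : c != 0 by rewrite gt_eqF.
  have hk (k : 'I_n) : k.+1%:R * h <= M / c.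
    rewrite /h mulrCA -[leRHS]mulr1 ler_wpM2l//; first by rewrite divr_ge0// ltW.
    by rewrite ler_pdivrMr ?ltr0n// mul1r ler_nat.
  apply: (@le_trans _ _ (\sum_(k < n) h%:E *
      \sum_(i | P i) mu (D i `&` [set x | (k.+1%:R * h)%:E <= f i x]))%E).
    apply: (@le_trans _ _ (\sum_(k < n) h%:E * (M - c * (k.+1%:R * h))%:E)%E).
      under eq_bigr do rewrite -EFinM.
      rewrite sumEFin lee_fin -mulr_sumr sumrB sumr_const card_ord.
      rewrite -mulr_sumr -mulr_suml -natr_sum.
      have -> : (\sum_(k < n) k.+1)%:R = n%:R * (n%:R + 1) / 2 :> R.
        elim: n {n0 n0' h h0 hk} => [|n IH]; first by rewrite big_ord0 !mul0r.
        by rewrite big_ord_recr/= natrD IH -natr1; field.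
      rewrite /h -mulr_natr le_eqVlt; apply/orP; left; apply/eqP.
      by field; rewrite c0' n0'.
    (* The mesh vanishes when [M = 0]; this case is separate because [superlevel] requires a
       positive level. *)
    apply: lee_sum => k _; have [h00|h00] := eqVneq h 0.
      by rewrite h00 !mul0e.
    rewrite lee_wpmul2l// ?lee_fin//; apply: superlevel => //.
    by rewrite mulr_gt0// lt_neqAle eq_sym h00.
  rewrite (eq_bigr (fun k : 'I_n => \sum_(i | P i) h%:E *
      mu (D i `&` [set x | ((k.+1%:R * h)%:E <= f i x)%E]))%E); last first.
    by move=> k _; rewrite ge0_sume_distrr// => i _; exact: measure_ge0.
  rewrite exchange_big/=; apply: lee_sum => i Pi.
  pose g (k : 'I_n) x :=
    ((h * (((k.+1%:R * h)%:E <= f i x)%E : bool)%:R)%:E : \bar R).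
  have gE (k : 'I_n) x : D i x -> g k x =
      (h%:E * (\1_(D i `&` [set x | ((k.+1%:R * h)%:E <= f i x)%E]) x)%:E)%E.
    move=> Dx; rewrite /g -EFinM indicE; congr (h * (nat_of_bool _)%:R)%:E.
    by apply/idP/idP; rewrite inE => // -[].
  have mg k : measurable_fun (D i) (g k).
    apply: (eq_measurable_fun (fun x => h%:E * (\1_(D i `&`
        [set x | ((k.+1%:R * h)%:E <= f i x)%E]) x)%:E)%E).
      by move=> x; rewrite inE => Dx; rewrite -gE.
    apply/measurable_funeM/measurable_EFinP/measurable_funTS/measurable_indic.
    exact: mge.
  have g0 k x : D i x -> (0 <= g k x)%E.
    by move=> _; rewrite lee_fin mulr_ge0.
  (* The weighted measures of the superlevel sets add up to the integral of a step function, which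
     lies below [f i] by [sum_steps_le]. *)
  apply: (@le_trans _ _ (\int[mu]_(x in D i) \sum_(k < n) g k x)%E); last first.
    apply: ge0_le_integral => //.
    - exact: mD.
    - by move=> x Dx; apply: sume_ge0 => k _; exact: g0.
    - exact: emeasurable_sum.
    - exact: mf.
    - by move=> x Dx; apply: sum_steps_le => //; exact: f0.
  rewrite ge0_integral_sum//; last exact: mD.
  apply: lee_sum => k _.
  rewrite (eq_integral (fun x => h%:E * (\1_(D i `&`
      [set x | ((k.+1%:R * h)%:E <= f i x)%E]) x)%:E)%E); last first.
    by move=> x; rewrite inE => Dx; exact: gE.
  rewrite ge0_integralZl ?lee_fin//; [|exact: mD|]; last first.
    by apply/measurable_EFinP/measurable_funTS/measurable_indic; exact: mge.
  rewrite integral_indic; [|exact: mD|exact: mge].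
  by rewrite setIAC setIid.
have B0 : 0 <= M ^+ 2 / (2 * c) by rewrite divr_ge0 ?sqr_ge0// mulr_ge0// ltW.
(* This replaces the limit in [n]: it suffices to reach every fraction [r < 1] of the bound, and
   [n > 1 / (1 - r)] gives [r <= 1 - 1 / n]. *)
apply/lee_mul01Pr; first by rewrite lee_fin.
move=> r /andP[r0 r1].
have r1' : 0 < (1 - r)^-1 by rewrite invr_gt0 subr_gt0.
have [n nr] : exists n, (1 - r)^-1 < n%:R.
  by exists (Num.bound (1 - r)^-1); apply: archi_boundP; exact: ltW.
have n0 : (0 < n)%N by rewrite -(ltr0n R) (lt_trans r1').
apply: le_trans (steps n n0); rewrite -EFinM lee_fin mulrC ler_wpM2l//.
rewrite lerBrDl -lerBrDr -[leRHS]invrK lef_pV2 ?posrE ?ltr0n//.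
exact: ltW.
Qed.

(** * Visits and ages *)

Section Patrol.
Variables (R : realType) (V : finType) (len : {set V} -> R) (w : int -> V).

Definition step (n : int) : {set V} := edge (w n) (w (n + 1)).

Lemma arrivalS n : arrival len w (n + 1) = arrival len w n + len (step n).
Proof.
case: n => [n|[|n]].
- have -> : Posz n + 1 = Posz n.+1 by lia.
  by rewrite /= big_ord_recr.
- rewrite NegzE addNr /= big_ord0 big_ord1 /step. by rewrite addNr.
- have -> : Negz n.+1 + 1 = Negz n by lia.
  rewrite /= [in RHS]big_ord_recr/= opprD /step.
  have -> : Negz n.+1 + 1 = Negz n by rewrite !NegzE; lia.
  by rewrite addrNK.
Qed.

Lemma arrival0 : arrival len w 0 = 0.
Proof. by rewrite /= big_ord0. Qed.

Variable adj : rel V.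
Hypothesis adj_irr : irreflexive adj.
Hypothesis len_gt0 : forall e : {set V}, e \in edges adj -> 0 < len e.
Hypothesis w_adj : forall n, adj (w n) (w (n + 1)).

Lemma edge_in (u v : V) : adj u v -> edge u v \in edges adj.
Proof. by move=> uv; apply/imsetP; exists (u, v); rewrite ?inE. Qed.

Lemma edgeC (u v : V) : edge u v = edge v u.
Proof. by rewrite /edge finset.setUC. Qed.

Lemma edge_eqP (u v u' v' : V) : u != v ->
  edge u' v' = edge u v -> (u' = u /\ v' = v) \/ (u' = v /\ v' = u).
Proof.
move=> uv e; have : u' \in edge u v by rewrite -e finset.set21.
have : v' \in edge u v by rewrite -e finset.set22.
rewrite !inE => /orP[]/eqP v'E /orP[]/eqP u'E; try by [left|right].
- have := finset.set22 u v; rewrite -/(edge u v) -e u'E v'E !inE orbb.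
  by rewrite eq_sym (negbTE uv).
- have := finset.set21 u v; rewrite -/(edge u v) -e u'E v'E !inE orbb.
  by rewrite (negbTE uv).
Qed.

Lemma step_gt0 n : 0 < len (step n).
Proof. exact/len_gt0/edge_in. Qed.

Lemma arrival_lt m n : m < n -> arrival len w m < arrival len w n.
Proof.
move=> mn; have -> : n = m + `|n - m|%N by lia.
have : (0 < `|n - m|)%N by lia.
elim: `|n - m|%N => // -[_ _|k IH _].
  by rewrite arrivalS ltrDl step_gt0.
rewrite -addn1 PoszD addrA arrivalS (lt_trans (IH isT))// ltrDl.
exact: step_gt0.
Qed.

Lemma arrival_le m n : m <= n -> arrival len w m <= arrival len w n.
Proof. by rewrite le_eqVlt => /orP[/eqP->|/arrival_lt/ltW]. Qed.

(** The finitely many edges have a positive minimal length, so the arrival times grow at least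
    linearly in both directions. Hence a bounded time window meets only finitely many steps. *)
Lemma arrival_unbounded (t : R) :
  exists N : nat, arrival len w (- N%:Z) < - t /\ t < arrival len w N%:Z.
Proof.
have [l l0 lE] : exists2 l : R, 0 < l & forall n, l <= len (step n).
  exists (\big[Order.min/1]_(e in edges adj) len e).
    by apply: lt_bigmin => // e; exact: len_gt0.
  by move=> n; apply: bigmin_le_cond; exact: edge_in.
have arr (n : nat) : arrival len w (- n%:Z) <= - (n%:R * l) /\
    n%:R * l <= arrival len w n%:Z.
  elim: n => [|n [IHN IH]]; first by rewrite oppr0 arrival0 !mul0r oppr0.
  split.
    have := arrivalS (- n.+1%:Z); have -> : - n.+1%:Z + 1 = - n%:Z by lia.
    by have := lE (- n.+1%:Z); rewrite -natr1; lra.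
  have := arrivalS n%:Z; have -> : n%:Z + 1 = n.+1%:Z by lia.
  by have := lE n%:Z; rewrite -natr1; lra.
have [N tN] : exists N : nat, `|t| / l < N%:R.
  by exists (Num.bound (`|t| / l)); apply: archi_boundP; rewrite divr_ge0// ltW.
exists N; have [arrN arrP] := arr N.
rewrite ltr_pdivrMr// in tN.
have := ler_norm t; lra.
Qed.

(* The time at which the [n]-th edge of the patrol, if it is {u, v}, passes the
   point at distance [x] from [u]. *)
Definition crossing (u v : V) (x : R) (n : int) : R :=
  if w n == u then arrival len w n + x
  else arrival len w n + (len (edge u v) - x).

(** Since [u] and [v] differ, the test [w n == u] in [crossing] tells the direction of travel, and
    the two cases of [visits] merge into one family indexed by the steps along the edge. *)
Lemma visitsE (u v : V) (x : R) : adj u v ->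
  visits len w u v x =
  [set s | exists2 n, step n = edge u v & s = crossing u v x n].
Proof.
move=> uv; have neq_uv : u != v.
  by apply/negP => /eqP uvE; move: uv; rewrite uvE adj_irr.
apply/seteqP; split=> s [n].
- move=> [[wn wn1 ->]|[wn wn1 ->]]; exists n.
  + by rewrite /step wn wn1.
  + by rewrite /crossing wn eqxx.
  + by rewrite /step wn wn1 edgeC.
  + by rewrite /crossing wn eq_sym (negbTE neq_uv).
- move=> /(edge_eqP neq_uv)[] [wn wn1] ->; exists n; rewrite /crossing wn.
    by left; rewrite eqxx.
  by right; rewrite eq_sym (negbTE neq_uv).
Qed.

Lemma crossing_itv (u v : V) (x : R) (n : int) : step n = edge u v ->
  0 < x < len (edge u v) ->
  arrival len w n < crossing u v x n < arrival len w (n + 1).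
Proof. by move=> nE; rewrite arrivalS nE /crossing; case: ifP => _; lra. Qed.

(** The strict inequality puts the supremum of the visits above [t - a], so some visit is above
    [t - a] too, whether or not the supremum is attained. *)
Lemma age_ltP (u v : V) (x t a : R) : adj u v ->
  (age len w u v x t < a%:E)%E ->
  exists2 n, step n = edge u v & t - a < crossing u v x n <= t.
Proof.
move=> uv; rewrite /age lte_subel_addr//.
move=> h; have /ereal_sup_gt[_ [s [+ st] <-]] :
    ((t - a)%:E < last_visit len w u v x t)%E.
  move: h; rewrite /last_visit; case: (ereal_sup _) => [r| |]//=.
    by rewrite -EFinD !lte_fin; lra.
  by move=> _; rewrite ltry.
rewrite visitsE// => -[n nE sE]; rewrite lte_fin => ts.
by exists n => //; rewrite -sE ts.
Qed.

Lemma age_ge0 (u v : V) (x t : R) : (0 <= age len w u v x t)%E.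
Proof.
rewrite /age /last_visit sube_ge0; last by apply/orP; right.
by apply: ge_ereal_sup => _ [s [_ st] <-]; rewrite lee_fin.
Qed.

Lemma age_le (u v : V) (x t : R) (n : int) : adj u v -> step n = edge u v ->
  crossing u v x n <= t -> (age len w u v x t <= (t - crossing u v x n)%:E)%E.
Proof.
move=> uv nE nt; rewrite EFinB /age leeB//.
apply: ereal_sup_ubound; exists (crossing u v x n) => //; split => //.
by rewrite visitsE//; exists n.
Qed.

(** Jointly in position and time: the last visit is after [y] exactly when one of the countably many
    crossings falls in []y, t]], and each crossing is affine in the position. *)
Lemma measurable_age (u v : V) : adj u v ->
  measurable_fun setT (fun z : R * R => age len w u v z.1 z.2).
Proof.
move=> uv; apply: emeasurable_funB.
  exact: (measurableT_comp (@EFin_measurable R setT) measurable_snd).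
move=> _; apply: (measurability _ (ErealGenOInfty.measurableE R)) => //.
move=> _ [_ [y ->] <-]; rewrite setTI.
rewrite [X in measurable X](_ : _ = \bigcup_(n : int)
    ([set z : R * R | step n = edge u v] `&`
     [set z | crossing u v z.1 n <= z.2] `&`
     [set z | y < crossing u v z.1 n])).
  apply: countable_bigcupT_measurable => // n.
  have mcr : measurable_fun setT (fun z : R * R => crossing u v z.1 n).
    rewrite /crossing; case: (w n == u).
      by apply: measurable_funD => //; exact: measurable_fst.
    apply: measurable_funD => //; exact: (measurable_funB (measurable_cst _) measurable_fst).
  apply: measurableI; first apply: measurableI.
  - have [nE|nE] := pselect (step n = edge u v).
      by rewrite (_ : [set _ | _] = setT)//; apply/seteqP; split.
    by rewrite (_ : [set _ | _] = set0)//; apply/seteqP; split.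
  - rewrite -[X in measurable X]setTI.
    exact: (measurable_fun_ler mcr measurable_snd).
  - rewrite -[X in measurable X]setTI.
    exact: (measurable_fun_ltr (measurable_cst y) mcr).
apply/seteqP; split => [[x t]|[x t] [n _]] /=; rewrite in_itv/= andbT.
- move=> /ereal_sup_gt[_ [s [+ st] <-]]; rewrite visitsE// => -[n nE sE].
  by rewrite lte_fin => ys; exists n => //=; rewrite -sE.
- move=> [[nE nt] yn]; apply: (@lt_le_trans _ _ (crossing u v x n)%:E).
    by rewrite lte_fin.
  apply: ereal_sup_ubound; exists (crossing u v x n) => //; split => //.
  by rewrite visitsE//; exists n.
Qed.

End Patrol.

(** * Points visited during a time window *)

(** Union bound for a cover by finitely many intervals. In the applications, the index [k] is a step
    and [P] selects the steps along one edge. *)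
Lemma lebesgue_cover_le (R : realType) (S : set R) (n : nat) (P : pred nat)
    (b g : nat -> R) : measurable S -> (forall k, 0 <= g k) ->
  (forall x, S x -> exists k, [/\ (k < n)%N, P k & b k <= x <= b k + g k]) ->
  (lebesgue_measure S <= (\sum_(k < n | P k) g k)%:E)%E.
Proof.
move=> mS g0 cover.
pose A k : set R := if P k then `[b k, b k + g k]%classic else set0.
have mA k : measurable (A k) by rewrite /A; case: ifP.
have muA k : (lebesgue_measure (A k) = (if P k then g k else 0)%:E)%E.
  rewrite /A; case: ifP => _; last exact: measure0.
  rewrite lebesgue_measure_itv/= lte_fin ltrDl; case: ltP => [_|gk].
    by rewrite -EFinD addrAC subrr add0r.
  by congr EFin; apply/le_anti; rewrite g0 gk.
apply: (@le_trans _ _ (lebesgue_measure (\big[setU/set0]_(k < n) A k))).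
  have mU : measurable (\big[setU/set0]_(k < n) A k).
    by apply: bigsetU_measurable => k _; exact: mA.
  apply: le_measure; rewrite ?inE//.
  move=> x /cover[k [kn Pk kx]]; apply: (bigsetU_sup kn).
  by rewrite /A /= Pk /= in_itv.
apply: le_trans; first by apply: Boole_inequality => k _; exact: mA.
by rewrite -sumEFin [leRHS]big_mkcond/=; apply: lee_sum => k _; rewrite muA; case: (P k).
Qed.

Section Lengths.
Variables (R : realType) (V : finType) (adj : rel V) (len : {set V} -> R).
Hypothesis adj_sym : symmetric adj.
Hypothesis adj_irr : irreflexive adj.
Hypothesis len_gt0 : forall e : {set V}, e \in edges adj -> 0 < len e.

Definition oriented (d : V * V) : bool :=
  adj d.1 d.2 && (enum_rank d.1 < enum_rank d.2)%N.

(** By symmetry both orientations of an edge are adjacent pairs, and by irreflexivity their ranks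
    differ, so exactly one of them is [oriented]. *)
Lemma sum_edges (U : nmodType) (F : {set V} -> U) :
  \sum_(d | oriented d) F (edge d.1 d.2) = \sum_(e in edges adj) F e.
Proof.
rewrite -(@big_imset _ _ _ _ _ (fun d : V * V => edge d.1 d.2) oriented)/=.
  apply: eq_bigl => e; apply/imsetP/imsetP => -[[u v]].
    by rewrite unfold_in /oriented/= => /andP[uv _] ->; exists (u, v); rewrite ?inE.
  rewrite inE/= => uv ->; have [ltuv|gtuv|/val_inj/enum_rank_inj eq_uv] :=
      ltngtP (enum_rank u) (enum_rank v).
  - by exists (u, v) => //; rewrite unfold_in /oriented/= uv.
  - exists (v, u); last exact: edgeC.
    by rewrite unfold_in /oriented/= adj_sym uv.
  - by rewrite eq_uv adj_irr in uv.
move=> [u v] [u' v']; rewrite !unfold_in /oriented/= => /andP[uv ltuv] /andP[_ lt'].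
have neq_uv : u != v by apply: contraTneq uv => ->; rewrite adj_irr.
move=> /esym/(edge_eqP neq_uv)[[-> ->]//|[uE vE]].
by rewrite uE vE ltnNge ltnW in lt'.
Qed.

Lemma total_lengthE :
  total_length len (edges adj) = \sum_(d | oriented d) len (edge d.1 d.2).
Proof. by rewrite /total_length sum_edges. Qed.

Lemma total_length_ge0 (F : {set {set V}}) :
  F \subset edges adj -> 0 <= total_length len F.
Proof. by move=> /fintype.subsetP FE; apply: sumr_ge0 => e /FE/len_gt0/ltW. Qed.

Variable w : int -> V.
Hypothesis w_adj : forall n, adj (w n) (w (n + 1)).

(* Clamping to [t - a, t] the time interval spent on each step turns the lengths
   visited in that window into a telescoping sum. *)
Lemma age_sublevel_le (t a : R) : 0 < a ->
  (\sum_(d | oriented d) lebesgue_measure (`]0%R, len (edge d.1 d.2)[ `&`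
     [set x | age len w d.1 d.2 x t < a%:E]) <= a%:E)%E.
Proof.
(* All times of the window [[t - a, t]] are at most [|t| + a] in absolute value, so the steps from
   [-N] to [N - 1] cover it. *)
move=> a0; have [N [arrN arrP]] :=
  arrival_unbounded len_gt0 w_adj (`|t| + a).
have [tabs tabs'] : t <= `|t| /\ - t <= `|t|.
  by split; [exact: ler_norm|rewrite -normrN ler_norm].
pose arr n := arrival len w n; pose c (s : R) : R := Order.max (t - a) (Order.min s t).
have c_le s s' : s <= s' -> c s <= c s'.
  move=> ss; rewrite /c; case: (leP s t) => ?; case: (leP s' t) => ?;
  case: (leP (t - a) s) => ?; case: (leP (t - a) s') => ?;
  by case: (leP (t - a) t) => ?; lra.
have cE s : t - a < s <= t -> c s = s.
  by move=> /andP[/ltW as_ st]; rewrite /c min_l// max_r.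
pose idx (k : nat) : int := k%:Z - N%:Z.
have idxS k : idx k.+1 = idx k + 1 by rewrite /idx; lia.
pose g k := c (arr (idx k.+1)) - c (arr (idx k)).
have g0 k : 0 <= g k.
  rewrite subr_ge0; apply/c_le/ltW/(arrival_lt len_gt0 w_adj).
  by rewrite idxS; lia.
apply: (@le_trans _ _ (\sum_(d | oriented d)
    (\sum_(k < N + N | step w (idx k) == edge d.1 d.2) g k)%:E)%E).
  apply: lee_sum => -[u v] /andP[/= uv _].
  (* The least distance from [u] reached during the clamped step: at its beginning when the UAV
     leaves [u], at its end when it heads for [u]. *)
  pose b k := if w (idx k) == u then c (arr (idx k)) - arr (idx k)
    else len (edge u v) + arr (idx k) - c (arr (idx k.+1)).
  apply: (@lebesgue_cover_le _ _ _ (fun k => step w (idx k) == edge u v) b) => //.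
    apply: measurableI => //; rewrite -[X in measurable X]setTI.
    apply: emeasurable_fun_infty_o => //.
    exact: (measurable_fun_pair1 t (measurable_age len w adj_irr uv)).
  move=> x [/=]; rewrite in_itv/= => x0l.
  move=> /(age_ltP adj_irr uv)[n nE nx].
  have /andP[n1 n2] := crossing_itv nE x0l.
  have n_lo : - N%:Z < n + 1.
    rewrite ltNge; apply/negP => /(arrival_le len_gt0 w_adj); lra.
  have n_hi : n < N%:Z.
    rewrite ltNge; apply/negP => /(arrival_le len_gt0 w_adj); lra.
  have idxn : idx (absz (n + N%:Z)) = n by rewrite /idx; lia.
  exists (absz (n + N%:Z)); rewrite idxn; split; [lia|exact/eqP|].
  have := c_le _ _ (ltW n1); have := c_le _ _ (ltW n2); rewrite !(cE _ nx).
  rewrite /b /g idxS idxn /crossing -/(arr n) -/(arr (n + 1)).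
  by case: (w n == u); lra.
rewrite sumEFin lee_fin.
under eq_bigr do rewrite big_mkcond/=.
rewrite exchange_big/=.
(* Each step runs along exactly one edge, so it is counted once in the sum over the edges. *)
have sum_step (k : nat) :
    \sum_(d | oriented d) (if step w (idx k) == edge d.1 d.2 then g k else 0) = g k.
  rewrite (sum_edges (fun e => if step w (idx k) == e then g k else 0)).
  rewrite (bigD1 (step w (idx k)))/=; last exact: edge_in.
  rewrite eqxx big1 ?addr0// => e /andP[_]; rewrite eq_sym.
  by move=> /negbTE ->.
rewrite (eq_bigr (fun k : 'I_(N + N) => g k)) => [|k _]; last exact: sum_step.
rewrite /g.
rewrite -(big_mkord xpredT (fun k => c (arr (idx k.+1)) - c (arr (idx k)))).
rewrite telescope_sumr//.
have -> : idx (N + N) = N by rewrite /idx; lia.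
have -> : idx 0 = - N%:Z by rewrite /idx; lia.
(* By the choice of [N], the extreme arrivals are clamped to [t - a] and [t], whose difference is
   [a]. *)
rewrite /c /arr [Order.min _ t]min_r; last by lra.
rewrite [Order.min _ t]min_l; last by lra.
by rewrite max_r ?max_l; lra.
Qed.

Lemma total_age_ge (t : R) :
  (((total_length len (edges adj)) ^+ 2 / 2)%:E <= total_age adj len w t)%E.
Proof.
rewrite -[in leLHS](mulr1 2); apply: sum_integral_ge => //.
- move=> [u v] /andP[/= uv _]; apply: measurable_funTS.
  exact: (measurable_fun_pair1 t (measurable_age len w adj_irr uv)).
- by move=> d x _ _; exact: age_ge0.
- exact: total_length_ge0.
- rewrite total_lengthE -sumEFin; apply: eq_bigr => -[u v] /andP[/= uv _].
  by rewrite lebesgue_measure_itv/= lte_fin (len_gt0 (edge_in uv)) sube0.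
- by move=> a a0 _; rewrite mul1r; exact: age_sublevel_le.
Qed.

End Lengths.

(** * Fubini and time averages *)

Section Fubini.
Context (d1 d2 : measure_display) (T1 : measurableType d1)
  (T2 : measurableType d2) (R : realType).
Variables (m1 : {sigma_finite_measure set T1 -> \bar R})
  (m2 : {sigma_finite_measure set T2 -> \bar R}) (f : T1 * T2 -> \bar R)
  (A : set T1) (B : set T2).
Hypotheses (mf : measurable_fun setT f) (f0 : forall z, (0 <= f z)%E)
  (mA : measurable A) (mB : measurable B).

Lemma measurable_fun_integral1 :
  measurable_fun setT (fun y => \int[m1]_(x in A) f (x, y))%E.
Proof.
have mS : measurable (A `*` [set: T2]) by exact: measurableX.
have mg : measurable_fun setT (f \_ (A `*` [set: T2])).
  exact/(measurable_restrictT _ mS)/measurable_funTS.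
have := measurable_fun_fubini_tonelli_G (m1 := m1) _ mg.
move=> /(_ (fun z => erestrict_ge0 (fun z _ => f0 z) z)).
apply: eq_measurable_fun => y _; rewrite /fubini_G [RHS]integral_mkcond.
by apply: eq_integral => x _; rewrite !patchE in_setX [y \in _]mem_set// andbT.
Qed.

Lemma measurable_fun_integral2 :
  measurable_fun setT (fun x => \int[m2]_(y in B) f (x, y))%E.
Proof.
have mS : measurable ([set: T1] `*` B) by exact: measurableX.
have mg : measurable_fun setT (f \_ ([set: T1] `*` B)).
  exact/(measurable_restrictT _ mS)/measurable_funTS.
have := measurable_fun_fubini_tonelli_F (m2 := m2) _ mg.
move=> /(_ (fun z => erestrict_ge0 (fun z _ => f0 z) z)).
apply: eq_measurable_fun => x _; rewrite /fubini_F [RHS]integral_mkcond.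
by apply: eq_integral => y _; rewrite !patchE in_setX [x \in _]mem_set.
Qed.

(** Tonelli over the whole product, applied to [f] extended by 0 outside the rectangle. *)
Lemma fubini_tonelli_in :
  (\int[m1]_(x in A) \int[m2]_(y in B) f (x, y) =
   \int[m2]_(y in B) \int[m1]_(x in A) f (x, y))%E.
Proof.
have mS : measurable (A `*` B) by exact: measurableX.
have mg : measurable_fun setT (f \_ (A `*` B)).
  exact/(measurable_restrictT _ mS)/measurable_funTS.
have := fubini_tonelli (m1 := m1) (m2 := m2) _ mg.
move=> /(_ (fun z => erestrict_ge0 (fun z _ => f0 z) z)) gE.
rewrite integral_mkcond [RHS]integral_mkcond.
transitivity (\int[m1]_x \int[m2]_y (f \_ (A `*` B)) (x, y))%E; last rewrite gE.
  apply: eq_integral => x _; rewrite patchE; case: ifPn => xA.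
    rewrite integral_mkcond; apply: eq_integral => y _.
    by rewrite !patchE in_setX xA.
  rewrite integral0_eq// => y _.
  by rewrite patchE in_setX (negbTE xA).
apply: eq_integral => y _; rewrite [RHS]patchE; case: ifPn => yB.
  rewrite [RHS]integral_mkcond; apply: eq_integral => x _.
  by rewrite !patchE in_setX yB andbT.
rewrite integral0_eq// => x _.
by rewrite patchE in_setX (negbTE yB) andbF.
Qed.

End Fubini.

(** * Limits sampled at multiples of a period *)

Lemma cvg_sampling (R : realType) (F : R -> \bar R) (L : R) : 0 < L ->
  cvg (F T @[T --> +oo]) ->
  F (n.+1%:R * L) @[n --> \oo] --> lim (F T @[T --> +oo]).
Proof.
move=> L0 /= Fcv; apply: (cvg_comp (fun n : nat => n.+1%:R * L) F) Fcv.
apply/cvgryPge => A; near=> n.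
rewrite -ler_pdivrMr// (le_trans (ler_norm _))//.
rewrite (le_trans (ltW (archi_boundP (normr_ge0 _))))// ler_nat ltnW//.
by near: n; exists (Num.bound (`|A / L|)).
Unshelve. all: by end_near. Qed.

(** Once the limit exists, whole numbers of periods suffice to bound it. The factor [1 - harmonic n]
    leaves room for the effect of one extra period, which fades as the number of periods grows. *)
Lemma lim_sampling_ge (R : realType) (F : R -> \bar R) (L B : R) : 0 < L ->
  cvg (F T @[T --> +oo]) ->
  (forall n, ((B * (1 - harmonic n))%:E <= F (n.+1%:R * L)%R)%E) ->
  (B%:E <= lim (F T @[T --> +oo%R]))%E.
Proof.
move=> L0 /(cvg_sampling L0) Fcv BF.
have Bcv : (B * (1 - harmonic n))%:E @[n --> \oo] --> B%:E.
  apply: cvg_EFin; first exact: nearW.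
  rewrite -[X in _ --> X](mulr1 B) -[X in _ --> B * X](subr0 1).
  by apply: cvgM; [exact: cvg_cst|apply: cvgB; [exact: cvg_cst|exact: cvg_harmonic]].
rewrite -(cvg_lim _ Fcv)// -(cvg_lim _ Bcv)//; apply: lee_lim.
- by apply/cvg_ex; exists B%:E.
- by apply/cvg_ex; eexists; exact: Fcv.
- exact: nearW.
Qed.

Lemma lim_sampling_le (R : realType) (F : R -> \bar R) (L B : R) : 0 < L ->
  cvg (F T @[T --> +oo]) ->
  (forall n, (F (n.+1%:R * L)%R <= (B * (1 + harmonic n))%:E)%E) ->
  (lim (F T @[T --> +oo%R]) <= B%:E)%E.
Proof.
move=> L0 /(cvg_sampling L0) Fcv BF.
have Bcv : (B * (1 + harmonic n))%:E @[n --> \oo] --> B%:E.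
  apply: cvg_EFin; first exact: nearW.
  rewrite -[X in _ --> X](mulr1 B) -[X in _ --> B * X](addr0 1).
  by apply: cvgM; [exact: cvg_cst|apply: cvgD; [exact: cvg_cst|exact: cvg_harmonic]].
rewrite -(cvg_lim _ Fcv)// -(cvg_lim _ Bcv)//; apply: lee_lim.
- by apply/cvg_ex; eexists; exact: Fcv.
- by apply/cvg_ex; exists B%:E.
- exact: nearW.
Qed.

(** * Mean age as an average over time at each point *)

Section MeanAge.
Variables (R : realType) (V : finType) (adj : rel V) (len : {set V} -> R).
Hypothesis adj_sym : symmetric adj.
Hypothesis adj_irr : irreflexive adj.
Hypothesis len_gt0 : forall e : {set V}, e \in edges adj -> 0 < len e.
Variable w : int -> V.

(** Tonelli for the nonnegative, jointly measurable age. With the time integral inside, the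
    estimates for periodic policies can be made one point at a time. *)
Lemma mean_ageE (T : R) : mean_age adj len w T = ((T^-1)%:E *
  \sum_(d | oriented adj d) \int[lebesgue_measure]_(x in `]0%R, len (edge d.1 d.2)[)
    \int[lebesgue_measure]_(t in `[0%R, T]) age len w d.1 d.2 x t)%E.
Proof.
rewrite /mean_age; congr (_ * _)%E; rewrite /total_age.
under eq_integral do rewrite big_mkcond/=.
rewrite ge0_integral_sum//; last 2 first.
- move=> d; apply: measurable_funTS.
  case: (boolP (adj d.1 d.2 && _)) => // /andP[uv _].
  apply: (measurable_fun_integral1 lebesgue_measure
    (measurable_age len w adj_irr uv)) => //.
  by move=> z; exact: age_ge0.
- move=> d t _; case: ifP => // _.
  by apply: integral_ge0 => x _; exact: age_ge0.
rewrite [RHS]big_mkcond/=; apply: eq_bigr => d _.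
rewrite /oriented; case: ifP => [/andP[uv _]|_]; last by rewrite integral0.
rewrite -(fubini_tonelli_in lebesgue_measure lebesgue_measure
  (measurable_age len w adj_irr uv))//.
by move=> z; exact: age_ge0.
Qed.

Hypothesis w_adj : forall n, adj (w n) (w (n + 1)).

Lemma mean_age_ge (T : R) : 0 < T ->
  ((total_length len (edges adj) ^+ 2 / 2)%:E <= mean_age adj len w T)%E.
Proof.
move=> T0; rewrite /mean_age lee_pdivlMl//.
set B := _ / 2.
have -> : (T%:E * B%:E = \int[lebesgue_measure]_(t in `[0%R, T]) cst B%:E t)%E.
  by rewrite integral_cst//= lebesgue_measure_itv/= lte_fin T0 sube0 muleC.
apply: ge0_le_integral => //.
- move=> t _; rewrite lee_fin /B divr_ge0// exprn_ge0//.
  exact/(total_length_ge0 len_gt0)/subxx.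
- apply: measurable_funTS; rewrite /total_age.
  under eq_fun do rewrite big_mkcond/=.
  apply: emeasurable_sum => d.
  case: (boolP (adj d.1 d.2 && _)) => // /andP[uv _].
  apply: (measurable_fun_integral1 lebesgue_measure
    (measurable_age len w adj_irr uv)) => //.
  by move=> z; exact: age_ge0.
- by move=> t _; exact: total_age_ge.
Qed.

Lemma AoI_policy_ge : cvg (mean_age adj len w T @[T --> +oo]) ->
  ((total_length len (edges adj) ^+ 2 / 2)%:E <= AoI adj len w)%E.
Proof.
move=> cv; apply: lime_ge => //; near=> T; apply: mean_age_ge.
by near: T; exact: nbhs_pinfty_gt.
Unshelve. all: by end_near. Qed.

End MeanAge.

(** * Periodic policies *)

(** The age accumulated over a duration [L] by a point visited at time [s] and not again. *)
Lemma integral_ramp (R : realType) (s L : R) : 0 < L ->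
  (\int[lebesgue_measure]_(t in `[s, (s + L)%R[) (t - s)%:E = (L ^+ 2 / 2)%:E)%E.
Proof.
move=> L0; have sL : s < s + L by rewrite ltrDl.
rewrite integral_itv_bndo_bndc; last first.
  apply/measurable_EFinP/measurable_funTS.
  exact: measurable_funB.
pose F (t : R) : R := (t - s) ^+ 2 / 2.
have F1 (t : R) : is_derive t 1 F (t - s).
  by rewrite /F; apply: is_derive_eq; rewrite /GRing.scale/=; field.
rewrite (@continuous_FTC2 _ (fun t => t - s) F)//.
- by rewrite /F -EFinB; congr EFin; field.
- apply: continuous_subspaceT => t; apply: cvgB; [exact: cvg_id|exact: cvg_cst].
- split=> [t _| |]; first by case: (F1 t).
  + apply: cvg_at_right_filter; apply: differentiable_continuous.
    by apply/derivable1_diffP; case: (F1 s).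
  + apply: cvg_at_left_filter; apply: differentiable_continuous.
    by apply/derivable1_diffP; case: (F1 (s + L)).
- by move=> t _; rewrite derive1E derive_val.
Qed.

Lemma sum_periodic (F : nat -> nat) (M N : nat) :
  (forall k, F (M + k)%N = F k) ->
  (\sum_(k < N * M) F k = N * \sum_(k < M) F k)%N.
Proof.
move=> FM; elim: N => [|N IH]; first by rewrite big_ord0.
rewrite mulSn big_split_ord/= mulSn -IH; congr addn.
by apply: eq_bigr => k _; rewrite FM.
Qed.

Section Periodic.
Variables (R : realType) (V : finType) (adj : rel V) (len : {set V} -> R).
Hypothesis adj_sym : symmetric adj.
Hypothesis adj_irr : irreflexive adj.
Hypothesis len_gt0 : forall e : {set V}, e \in edges adj -> 0 < len e.
Variables (w : int -> V) (M : nat).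
Hypothesis w_adj : forall n, adj (w n) (w (n + 1)).
Hypothesis M_gt0 : (0 < M)%N.
Hypothesis w_periodic : forall n : int, w (n + M%:Z) = w n.

Definition multiplicity (e : {set V}) : nat := \sum_(k < M) (step w k == e).

Hypothesis multiplicity_gt0 : forall e, e \in edges adj -> (0 < multiplicity e)%N.

Let L := arrival len w M.

Lemma step_periodic n : step w (n + M%:Z) = step w n.
Proof. by rewrite /step addrAC !w_periodic. Qed.

Lemma period_gt0 : 0 < L.
Proof. by rewrite -(arrival0 len w); apply: (arrival_lt len_gt0 w_adj); lia. Qed.

Lemma arrivalDperiod n : arrival len w (n + M%:Z) = arrival len w n + L.
Proof.
elim: n => [|n IH|n IH]; first by rewrite add0r arrival0 add0r.
  have -> : n.+1%:Z = n%:Z + 1 by lia.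
  by rewrite addrAC !arrivalS IH step_periodic addrAC.
(* Downwards, the equation at [-n] is unfolded one step back and the common step length is
   cancelled. *)
have nE : - n%:Z = - n.+1%:Z + 1 by lia.
move: IH; rewrite nE addrAC !arrivalS step_periodic.
by rewrite [RHS]addrAC => /addIr.
Qed.

Lemma arrival_mul_period (N : nat) :
  arrival len w ((N * M)%N : int) = N%:R * L.
Proof.
elim: N => [|N IH]; first by rewrite mul0n arrival0 mul0r.
by rewrite mulSn addnC PoszD arrivalDperiod IH -natr1 mulrDl mul1r.
Qed.

Lemma crossingDperiod (u v : V) (x : R) (n : int) (j : nat) :
  crossing len w u v x (n + (j * M)%N%:Z) = crossing len w u v x n + j%:R * L.
Proof.
elim: j => [|j IH]; first by rewrite mul0n addr0 mul0r addr0.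
have -> : n + (j.+1 * M)%N%:Z = n + (j * M)%N%:Z + M%:Z.
  by rewrite mulSn PoszD; ring.
rewrite -natr1 mulrDl mul1r addrA -IH /crossing w_periodic arrivalDperiod.
by case: ifP => _; ring.
Qed.

(** * A fixed point under a periodic policy *)

Section Point.
Variables (u v : V) (x : R).
Hypotheses (uv : adj u v) (x_itv : 0 < x < len (edge u v)).
Let m := multiplicity (edge u v).

Let m_gt0 : (0 < m)%N.
Proof. exact/multiplicity_gt0/edge_in. Qed.

Lemma measurable_age_time (D : set R) : measurable_fun D (age len w u v x).
Proof.
apply: measurable_funTS.
exact: (measurable_fun_pair2 x (measurable_age len w adj_irr uv)).
Qed.

(** An age below [a] at time [t] requires a crossing at most [a] earlier, so each crossing accounts
    for a time interval of length [a]. As [a <= L], the relevant crossings belong to the [N] periods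
    of the window or to the one before time 0, with [m] crossings in each. *)
Lemma age_sublevel_time_le (N : nat) (a : R) : 0 < a -> a <= L ->
  (lebesgue_measure (`[0%R, (N%:R * L)%R] `&`
     [set t | age len w u v x t < a%:E])
   <= (m%:R * N.+1%:R * a)%:E)%E.
Proof.
move=> a0 aL; pose idx (k : nat) : int := k%:Z - M%:Z.
have stepE k : step w (idx k) = step w k.
  by rewrite -(step_periodic (idx k)) /idx subrK.
apply: (@le_trans _ _
    (\sum_(k < N.+1 * M | step w (idx k) == edge u v) a)%:E).
  apply: (@lebesgue_cover_le _ _ _ (fun k => step w (idx k) == edge u v)
    (fun k => crossing len w u v x (idx k)) (fun=> a)) => //.
  - apply: emeasurable_fun_infty_o => //; exact: measurable_age_time.
  - by move=> _; exact: ltW.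
  move=> t [/=]; rewrite in_itv/= => t_itv /(age_ltP adj_irr uv)[n nE nt].
  have /andP[n1 n2] := crossing_itv nE x_itv.
  have n_lo : - M%:Z < n + 1.
    rewrite ltNge; apply/negP => /(arrival_le len_gt0 w_adj).
    have := arrivalDperiod (- M%:Z); rewrite addNr arrival0; lra.
  have n_hi : n < (N * M)%N%:Z.
    rewrite ltNge; apply/negP => /(arrival_le len_gt0 w_adj).
    rewrite arrival_mul_period; lra.
  have idxn : idx (absz (n + M%:Z)) = n by rewrite /idx; lia.
  exists (absz (n + M%:Z)); rewrite idxn; split; [|exact/eqP|lra].
  by rewrite mulSn; lia.
rewrite lee_fin big_mkcond/= (eq_bigr (fun k : 'I_(N.+1 * M) =>
    (nat_of_bool (step w k == edge u v))%:R * a)); last first.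
  by move=> k _; rewrite stepE; case: eqP => _; rewrite ?mul1r ?mul0r.
rewrite -mulr_suml -natr_sum.
rewrite (@sum_periodic (fun k => step w k == edge u v)); last first.
  by move=> k; rewrite PoszD addrC step_periodic.
by rewrite natrM [m%:R * _]mulrC.
Qed.

Lemma integral_age_ge (N : nat) : (((N%:R * L) ^+ 2 / (2 * (m%:R * N.+1%:R)))%:E
  <= \int[lebesgue_measure]_(t in `[0%R, (N%:R * L)%R]) age len w u v x t)%E.
Proof.
have L0 := period_gt0; have m0 : 0 < m%:R :> R by rewrite ltr0n.
(* The layer-cake estimate in the time variable, with a single summand. The levels stay below
   [N L / (m (N + 1))], hence below [L], as the sublevel bound requires. *)
have := @sum_integral_ge _ _ R lebesgue_measure 'I_1 xpredT
  (fun=> `[0, N%:R * L]%classic) (fun=> age len w u v x) (N%:R * L)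
  (m%:R * N.+1%:R).
rewrite !big_ord1; apply => //.
- by move=> _ _; exact: measurable_age_time.
- by move=> _ t _ _; exact: age_ge0.
- by rewrite mulr_ge0// ltW.
- by rewrite mulr_gt0// ltr0n.
- apply: etrans; first exact: lebesgue_measure_itv.
  rewrite /= lte_fin.
  case: ltP => [_|NL]; first by rewrite sube0.
  by congr EFin; apply/le_anti; rewrite NL mulr_ge0// ltW.
- move=> a a0 aN; rewrite big_ord1; apply: age_sublevel_time_le => //.
  apply: (le_trans aN); rewrite ler_pdivrMr; last by rewrite mulr_gt0// ltr0n.
  rewrite mulrC ler_wpM2l ?(ltW L0)//.
  by rewrite -natrM ler_nat (leq_trans (leqnSn N))// leq_pmull.
Qed.

(** Follow one step along the edge and its translates: they cross the point at [s + j L], with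
    [-L <= s <= 0]. Between consecutive ones the age is at most the time since the earlier one,
    which integrates to [L^2 / 2], and [N + 1] such intervals cover the window. *)
Lemma integral_age_le (N : nat) :
  (\int[lebesgue_measure]_(t in `[0%R, (N%:R * L)%R]) age len w u v x t
  <= (N.+1%:R * L ^+ 2 / 2)%:E)%E.
Proof.
have L0 := period_gt0.
have [k /eqP kE] : exists k : 'I_M, step w k == edge u v.
  apply/existsP; move: m_gt0; rewrite /m /multiplicity lt0n.
  apply: contraR => /existsPn no; apply/eqP; rewrite big1// => k _.
  by rewrite (negbTE (no k)).
pose n0 : int := k%:Z - M%:Z; pose s := crossing len w u v x n0.
have n0E : step w n0 = edge u v by rewrite -step_periodic /n0 subrK.
have /andP[s_lo s_hi] := crossing_itv n0E x_itv; rewrite -/s in s_lo s_hi.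
have s0 : s <= 0.
  apply/ltW/(lt_le_trans s_hi); rewrite -(arrival0 len w).
  by apply: (arrival_le len_gt0 w_adj); rewrite /n0; have := ltn_ord k; lia.
have sL : - L <= s.
  apply/ltW/(le_lt_trans _ s_lo).
  have -> : - L = arrival len w (- M%:Z).
    by have := arrivalDperiod (- M%:Z); rewrite addNr arrival0; lra.
  by apply: (arrival_le len_gt0 w_adj); rewrite /n0; lia.
apply: (@le_trans _ _ (\int[lebesgue_measure]_(t in
    `[s, (s + N.+1%:R * L)%R]) age len w u v x t)%E).
  apply: ge0_subset_integral => //.
  - exact: measurable_age_time.
  - by move=> t _; exact: age_ge0.
  - by move=> t /=; rewrite !in_itv/= -natr1 mulrDl; lra.
rewrite -integral_itv_bndo_bndc; last exact: measurable_age_time.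
elim: N.+1 => [|j IH].
  by rewrite mul0r addr0 set_itvco0 integral_set0 mul0r.
have sj0 : s <= s + j%:R * L by rewrite lerDl mulr_ge0// ltW.
have sj1 : s + j%:R * L <= s + j.+1%:R * L.
  by rewrite lerD2l ler_wpM2r ?(ltW L0)// ler_nat.
rewrite (@itv_bndbnd_setU _ _ _ (BLeft (s + j%:R * L)))//.
rewrite ge0_integral_setU//; last 3 first.
- exact: measurable_age_time.
- by move=> t _; exact: age_ge0.
- apply/disj_setPS => t []/=; rewrite !in_itv/=; lra.
rewrite -natr1 !mulrDl !mul1r EFinD; apply: leeD => //.
rewrite -(integral_ramp (s + j%:R * L) L0) addrA.
apply: ge0_le_integral => //.
- by move=> t _; exact: age_ge0.
- exact: measurable_age_time.
- apply/measurable_EFinP/measurable_funTS; exact: measurable_funB.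
move=> t /=; rewrite in_itv/= => /andP[ts _].
have -> : s + j%:R * L = crossing len w u v x (n0 + (j * M)%N%:Z).
  by rewrite crossingDperiod.
apply: age_le => //; last by rewrite crossingDperiod.
elim: {IH sj0 sj1 ts} j => [|j IH]; first by rewrite mul0n addr0.
by rewrite mulSn addnC PoszD addrA step_periodic.
Qed.

End Point.

Lemma AoI_periodic_ge : cvg (mean_age adj len w T @[T --> +oo]) ->
  ((L * \sum_(e in edges adj) len e / (2 * (multiplicity e)%:R))%:E
   <= AoI adj len w)%E.
Proof.
have L0 := period_gt0.
move=> cv; apply: (lim_sampling_ge L0) => // n.
rewrite (mean_ageE _ adj_irr).
rewrite lee_pdivlMl ?mulr_gt0// -EFinM.
set c := (X in (X%:E <= _)%E).
apply: (@le_trans _ _ (\sum_(d | oriented adj d) (len (edge d.1 d.2) *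
  ((n.+1%:R * L) ^+ 2 / (2 * ((multiplicity (edge d.1 d.2))%:R * n.+2%:R))))%:E)%E).
  rewrite sumEFin lee_fin (sum_edges adj_sym adj_irr (fun e => len e *
    ((n.+1%:R * L) ^+ 2 / (2 * ((multiplicity e)%:R * n.+2%:R))))).
  rewrite /c [L * _]mulr_sumr mulr_suml mulr_sumr.
  apply: ler_sum => e eE; set me := (multiplicity e)%:R.
  have me0 : 0 < me :> R by rewrite ltr0n multiplicity_gt0.
  have le0 := len_gt0 eE.
  have -> : n.+1%:R * L * (L * (len e / (2 * me)) * (1 - harmonic n)) =
      len e * L ^+ 2 / (2 * me) * (n.+1%:R * (1 - harmonic n)) by ring.
  have -> : len e * ((n.+1%:R * L) ^+ 2 / (2 * (me * n.+2%:R))) =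
      len e * L ^+ 2 / (2 * me) * (n.+1%:R ^+ 2 / n.+2%:R).
    by field; rewrite -natrD pnatr_eq0 (gt_eqF me0).
  rewrite ler_wpM2l//.
    by rewrite divr_ge0// ?mulr_ge0 ?sqr_ge0 ?ltW.
  (* With [N = n + 1] periods, what remains is [N - 1 <= N^2 / (N + 1)]. *)
  rewrite /harmonic ler_pdivlMr ?ltr0n// -[n.+2%:R]natr1.
  rewrite mulrBr mulr1 divff ?pnatr_eq0//.
  by have : 0 <= n.+1%:R :> R by []; nra.
apply: lee_sum => -[u v] /andP[/= uv _].
have -> : ((len (edge u v) *
  ((n.+1%:R * L) ^+ 2 / (2 * ((multiplicity (edge u v))%:R * n.+2%:R))))%:E
  = \int[lebesgue_measure]_(x in `]0%R, len (edge u v)[) cst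
  ((n.+1%:R * L) ^+ 2 / (2 * ((multiplicity (edge u v))%:R * n.+2%:R)))%:E x)%E.
  rewrite integral_cst//= lebesgue_measure_itv/= lte_fin.
  by rewrite (len_gt0 (edge_in uv)) sube0 -EFinM mulrC.
apply: ge0_le_integral => //.
- by move=> x _; rewrite lee_fin divr_ge0 ?sqr_ge0.
- apply: measurable_funTS.
  apply: (measurable_fun_integral2 lebesgue_measure
    (measurable_age len w adj_irr uv)) => //.
  by move=> z; exact: age_ge0.
- by move=> x /=; rewrite in_itv/= => x_itv; exact: integral_age_ge.
Qed.

(* If the limit does not exist, then [lim] has the default value 0. *)
Lemma AoI_periodic_le :
  (AoI adj len w <= (total_length len (edges adj) * L / 2)%:E)%E.
Proof.
have L0 := period_gt0.
have lE0 := total_length_ge0 len_gt0 (fintype.subxx (edges adj)).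
have [cv|/dvgP ncv] := pselect (cvg (mean_age adj len w T @[T --> +oo])); last first.
  by rewrite /AoI ncv lee_fin divr_ge0// mulr_ge0// ltW.
apply: (lim_sampling_le L0) => // n.
rewrite (mean_ageE _ adj_irr).
rewrite lee_pdivrMl ?mulr_gt0// -EFinM.
apply: (@le_trans _ _ (\sum_(d | oriented adj d) (len (edge d.1 d.2) *
  (n.+2%:R * L ^+ 2 / 2))%:E)%E); last first.
  rewrite sumEFin lee_fin -mulr_suml -(total_lengthE len adj_sym adj_irr).
  have -> : n.+2%:R = n.+1%:R * (1 + harmonic n) :> R.
    by rewrite /harmonic mulrDr mulr1 divff ?pnatr_eq0// natr1.
  by rewrite le_eqVlt; apply/orP; left; apply/eqP; ring.
apply: lee_sum => -[u v] /andP[/= uv _].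
have -> : ((len (edge u v) * (n.+2%:R * L ^+ 2 / 2))%:E
  = \int[lebesgue_measure]_(x in `]0%R, len (edge u v)[) cst
  (n.+2%:R * L ^+ 2 / 2)%:E x)%E.
  rewrite integral_cst//= lebesgue_measure_itv/= lte_fin.
  by rewrite (len_gt0 (edge_in uv)) sube0 -EFinM mulrC.
apply: ge0_le_integral => //.
- by move=> x _; apply: integral_ge0 => t _; exact: age_ge0.
- apply: measurable_funTS.
  apply: (measurable_fun_integral2 lebesgue_measure
    (measurable_age len w adj_irr uv)) => //.
  by move=> z; exact: age_ge0.
- by move=> x /=; rewrite in_itv/= => x_itv; exact: integral_age_le.
Qed.

End Periodic.

(** * Routes *)

(** The denominator may be [+oo], in which case the quotient is 0. *)
Lemma lee_div_bounds (R : realType) (x y : \bar R) (A B : R) :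
  (x <= A%:E)%E -> 0 <= A -> (B%:E <= y)%E -> 0 < B ->
  (x / y <= (A / B)%:E)%E.
Proof.
move=> xA A0 By B0.
have y0 : (0 <= y^-1)%E.
  by rewrite inve_ge0 (le_trans _ By)// lee_fin ltW.
rewrite (le_trans (lee_wpmul2r y0 xA))//.
case: y By {y0} => [y| |]//=; last by rewrite invey mule0 lee_fin divr_ge0// ltW.
rewrite lee_fin => By; have y0 := lt_le_trans B0 By.
by rewrite inver gt_eqF// -EFinM lee_fin ler_wpM2l// lef_pV2.
Qed.

Section ClosedWalk.
Variables (R : realType) (V : finType) (adj : rel V) (len : {set V} -> R).
Hypothesis adj_sym : symmetric adj.
Hypothesis adj_irr : irreflexive adj.
Hypothesis len_gt0 : forall e : {set V}, e \in edges adj -> 0 < len e.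
Variables (x : V) (p : seq V).
Hypothesis xp_route : route adj x p.

Let w := forever x p.
Let M := size p.

Let M_gt0 : (0 < M)%N.
Proof. by case: xp_route => -[+ _ _] _; rewrite -size_eq0 lt0n. Qed.

Lemma forever_periodic (n : int) : w (n + M%:Z) = w n.
Proof. by rewrite /w /forever modzDr. Qed.

(** At [k = M] the left side wraps around to [x] and the right side is the last node; they agree
    because the walk is closed. *)
Lemma forever_nth (k : nat) : (k <= M)%N -> w k = nth x (x :: p) k.
Proof.
rewrite leq_eqVlt => /orP[/eqP->|kM].
  rewrite -[M%:Z]add0r forever_periodic /w /forever mod0z/=.
  by case: xp_route => -[_ _ xE] _; rewrite -[M]/(size (x :: p)).-1 nth_last/= xE.
by rewrite /w /forever modz_small//.
Qed.

Lemma forever_step (k : nat) : (k < M)%N ->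
  w k = nth x (x :: p) k /\ w (k%:Z + 1) = nth x p k.
Proof.
move=> kM; split; first exact/forever_nth/ltnW.
have -> : k%:Z + 1 = k.+1 by lia.
exact: forever_nth.
Qed.

Lemma forever_adj n : adj (w n) (w (n + 1)).
Proof.
have M0 : M%:Z != 0 by move: M_gt0; lia.
pose k := absz (n %% M%:Z)%Z.
have kE : k%:Z = (n %% M%:Z)%Z by rewrite /k; have := modz_ge0 n M0; lia.
have kM : (k < M)%N.
  have : (n %% M%:Z)%Z < M by apply: ltz_pmod; move: M_gt0; lia.
  by rewrite -kE; lia.
have wE j : w (n + j) = w (k%:Z + j) by rewrite /w /forever kE modzDml.
have := wE 0; rewrite !addr0 wE => ->.
have [-> ->] := forever_step kM.
by case: xp_route => -[_ /(pathP x)/(_ k kM) adjk _] _.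
Qed.

Lemma multiplicity_forever e : multiplicity w M e = traversals x p e.
Proof.
have sz : size (zip (x :: p) p) = M.
  by rewrite size_zip (minn_idPr (leqnSn (size p))).
rewrite /traversals -sum1_count (big_nth (x, x)) sz big_mkord big_mkcond/=.
apply: eq_bigr => k _; rewrite nth_zip_cond sz ltn_ord/= /step.
by have [-> ->] := forever_step (ltn_ord k); case: eqP.
Qed.

Lemma multiplicity_forever_gt0 e : e \in edges adj -> (0 < multiplicity w M e)%N.
Proof.
by move=> eE; rewrite multiplicity_forever; have /andP[] := xp_route.2 e eE.
Qed.

Let lE := total_length len (edges adj).
Let l1 := total_length len (traversed_once adj x p).

Lemma traversed_onceE :
  l1 = \sum_(e in edges adj) if traversals x p e == 1%N then len e else 0.
Proof.
by rewrite /l1 /total_length -big_mkcondr; apply: eq_bigl => e; rewrite !inE.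
Qed.

Lemma traversed_once_bounds : 0 <= l1 <= lE.
Proof.
rewrite traversed_onceE /lE /total_length sumr_ge0/= => [|e eE]; last first.
  by case: ifP => // _; exact/ltW/len_gt0.
by apply: ler_sum => e eE; case: ifP => // _; exact/ltW/len_gt0.
Qed.

Lemma total_length_gt0 : 0 < lE.
Proof.
have e0E : step w 0 \in edges adj by exact/edge_in/forever_adj.
rewrite /lE /total_length (bigD1 _ e0E)/= ltr_pwDl ?len_gt0//.
by apply: sumr_ge0 => e /andP[eE _]; exact/ltW/len_gt0.
Qed.

(** Grouped by edges, the steps give each edge its multiplicity, which is 2, less 1 for the edges
    traversed once. *)
Lemma route_length : arrival len w M = 2 * lE - l1.
Proof.
transitivity (\sum_(e in edges adj) (multiplicity w M e)%:R * len e).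
  under [RHS]eq_bigr do rewrite /multiplicity natr_sum mulr_suml.
  rewrite exchange_big/=; apply: eq_bigr => k _.
  rewrite (bigD1 (step w k))/=; last exact/edge_in/forever_adj.
  rewrite eqxx mul1r big1 ?addr0// => e /andP[_].
  by rewrite eq_sym => /negbTE ->; rewrite mul0r.
rewrite traversed_onceE /lE /total_length mulr_sumr -sumrB.
apply: eq_bigr => e eE; rewrite multiplicity_forever.
have := xp_route.2 e eE; case: (traversals x p e) => [|[|[|]]]//= _; ring.
Qed.

Lemma AoI_route_le : (AoI adj len w <= (lE ^+ 2 - 2^-1 * lE * l1)%:E)%E.
Proof.
have -> : lE ^+ 2 - 2^-1 * lE * l1 = lE * arrival len w M / 2.
  by rewrite route_length; field.
exact: (AoI_periodic_le adj_sym adj_irr len_gt0 forever_adj M_gt0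
  forever_periodic multiplicity_forever_gt0).
Qed.

(** An edge contributes half its length when traversed once and a quarter when traversed twice, so
    the sum in [AoI_periodic_ge] is [(lE + l1) / 4]. Multiplying by the period [2 lE - l1] gives the
    stated form. *)
Lemma AoI_route_ge : cvg (mean_age adj len w T @[T --> +oo]) ->
  ((2^-1 * lE ^+ 2 + 4^-1 * l1 * (lE - l1))%:E <= AoI adj len w)%E.
Proof.
move=> cv; apply: le_trans (AoI_periodic_ge adj_sym adj_irr len_gt0 forever_adj
  M_gt0 forever_periodic multiplicity_forever_gt0 cv).
have -> : \sum_(e in edges adj) len e / (2 * (multiplicity w M e)%:R) =
    4^-1 * (lE + l1).
  rewrite traversed_onceE /lE /total_length -big_split mulr_sumr.
  apply: eq_bigr => e eE; rewrite multiplicity_forever.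
  by have := xp_route.2 e eE; case: (traversals x p e) => [|[|[|]]]//= _; field.
by rewrite lee_fin route_length le_eqVlt; apply/orP; left; apply/eqP; field.
Qed.

End ClosedWalk.

Lemma postman_route_route (R : realType) (V : finType) (adj : rel V)
    (len : {set V} -> R) (x : V) (p : seq V) :
  postman_route adj len x p -> route adj x p.
Proof.
by move=> [D [_ xp mult]]; split=> // e /mult ->; case: (e \in D).
Qed.

Theorem theorem2 (R : realType) (V : finType) (adj : rel V)
    (len : {set V} -> R)
    (adj_sym : symmetric adj) (adj_irr : irreflexive adj)
    (adj_conn : forall u v : V, connect adj u v)
    (len_gt0 : forall e : {set V}, e \in edges adj -> 0 < len e)
    (x3 : V) (p3 : seq V) (R3_postman : postman_route adj len x3 p3) :
  let lE := total_length len (edges adj) in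
  let l1 := total_length len (traversed_once adj x3 p3) in
  (forall (x1 : V) (p1 : seq V),
     route adj x1 p1 ->
     optimal adj len (route_policies adj) (forever x1 p1) ->
     let l1s := total_length len (traversed_once adj x1 p1) in
     let bound := (lE ^+ 2 - 2^-1 * lE * l1)
                  / (2^-1 * lE ^+ 2 + 4^-1 * l1s * (lE - l1s)) in
     (AoI adj len (forever x3 p3) / AoI adj len (forever x1 p1) <= bound%:E)%E
     /\ bound <= 2)
  /\
  (forall w : int -> V,
     optimal adj len (patrol_policies adj len) w ->
     let bound := (lE ^+ 2 - 2^-1 * lE * l1) / (2^-1 * lE ^+ 2) in
     (AoI adj len (forever x3 p3) / AoI adj len w <= bound%:E)%E
     /\ bound <= 2).
Proof.
move=> lE l1; have r3 := postman_route_route R3_postman.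
have lE0 : 0 < lE := total_length_gt0 len_gt0 r3.
have /andP[l1_ge0 l1_le] : 0 <= l1 <= lE := traversed_once_bounds len_gt0 x3 p3.
have AoI3 := AoI_route_le adj_sym adj_irr len_gt0 r3.
have num0 : 0 <= lE ^+ 2 - 2^-1 * lE * l1 by nra.
split=> [x1 p1 r1 [_ cv _] l1s bound|w [[w_adj _ _] cv _] bound].
  have /andP[l1s_ge0 l1s_le] : 0 <= l1s <= lE := traversed_once_bounds len_gt0 x1 p1.
  have den0 : 0 < 2^-1 * lE ^+ 2 + 4^-1 * l1s * (lE - l1s) by nra.
  (* The numerator is at most [lE^2] and the denominator at least half of that. *)
  split; last by rewrite /bound ler_pdivrMr//; nra.
  by apply: lee_div_bounds => //; exact: AoI_route_ge.
have den0 : 0 < 2^-1 * lE ^+ 2 by nra.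
split; last by rewrite /bound ler_pdivrMr//; nra.
apply: lee_div_bounds => //; rewrite mulrC.
exact: AoI_policy_ge.
Qed.
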